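(* Let $k\ge 2$ be an integer and let $p_{-k}(n)$ denote the number of $k$-colored partitions of $n$. For any positive integers $a\ge b$, $$p_{-k}(a)\,p_{-k}(b)>p_{-k}(a+b),$$ except for $(a,b,k)\in\{(1,1,2),(2,1,2),(3,1,2),(1,1,3)\}$.
   Context: A $k$-colored partition of a nonnegative integer $n$ is a partition of $n$ in which each part is assigned one of $k$ colors $1,\dots,k$; two $k$-colored partitions are the same if they have the same multiset of (size, color) pairs. Equivalently, $\sum_{n\ge0}p_{-k}(n)q^n=\prod_{m\ge1}(1-q^m)^{-k}$. *)

(* Defs.v *)
From mathcomp Require Import all_boot.

Set Implicit Arguments.
Unset Strict Implicit.
Unset Printing Implicit Defensive.

(* A multiset of (size, color) pairs is given by its multiplicity function:
   m (i, c) is the number of parts of size i.+1 with color c.  In a partition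
   of n, sizes lie between 1 and n and no multiplicity exceeds n, so the bounds
   below lose nothing. *)
Definition is_colored_partition (k n : nat)
    (m : {ffun 'I_n * 'I_k -> 'I_n.+1}) : bool :=
  \sum_(x : 'I_n * 'I_k) m x * x.1.+1 == n.

Definition num_colored_partitions (k n : nat) : nat :=
  #|[set m : {ffun 'I_n * 'I_k -> 'I_n.+1} | is_colored_partition m]|.

(* Main.v *)
Require Import Defs.
From mathcomp Require Import all_boot.
From mathcomp Require Import zify.

(* Summing all parts over all k-colored partitions of n gives
   n P(n) = k \sum_(1 <= m <= n) sigma(m) P(n - m).  Applying this to P(a),
   P(b) and P(a + b) with b <= a writes (a + b) (P(a) P(b) - P(a + b)) / k as
     \sum_(m <= a) sigma(m) (P(a - m) P(b) - P(a + b - m))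
     + \sum_(m <= b) (sigma(m) P(a) - sigma(a + m)) P(b - m).
   By induction on a + b the first sum is nonnegative, and the second is
   positive for a >= 2 because P(a) >= a^2 + a + 2 once a >= 5.  The only
   negative term that can occur, from P(1) P(1) < P(2) when k = 2, matters for
   b = 1 and is then absorbed by P(a) > sigma(a - 1) + sigma(a + 1) once
   a >= 4. *)

Definition sigma (n : nat) : nat := \sum_(1 <= d < n.+1 | d %| n) d.

(** * Counting colored partitions inside a common finite type *)

Lemma card_can_in {T U : finType} {A : {set T}} {B : {set U}}
    (f : T -> U) (g : U -> T) :
  {in A, forall x, f x \in B} -> {in B, forall y, g y \in A} ->
  {in A, cancel f g} -> {in B, cancel g f} -> #|A| = #|B|.
Proof.
move=> fAB gBA fK gK.
rewrite -(card_in_imset (can_in_inj fK)).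
apply: eq_card => y; apply/imsetP/idP => [[x xA ->]|yB]; first exact: fAB.
by exists (g y); rewrite ?gBA ?gK.
Qed.

(** The bound [N] is decoupled from [n], so that removing parts, which changes [n], stays within one
    type. *)
Definition bounded_colored_partitions (N k n : nat) :
    {set {ffun 'I_N * 'I_k -> 'I_N.+1}} :=
  [set m : {ffun 'I_N * 'I_k -> 'I_N.+1} |
    \sum_(x : 'I_N * 'I_k) m x * x.1.+1 == n].

Lemma colored_partition_term {N k n : nat}
    {m : {ffun 'I_N * 'I_k -> 'I_N.+1}} (x : 'I_N * 'I_k) :
  m \in bounded_colored_partitions N k n -> m x * x.1.+1 <= n.
Proof. by rewrite inE => /eqP <-; rewrite (bigD1 x) //= leq_addr. Qed.

Lemma colored_partition_mult_le {N k n : nat}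
    {m : {ffun 'I_N * 'I_k -> 'I_N.+1}} (x : 'I_N * 'I_k) :
  m \in bounded_colored_partitions N k n -> m x <= n.
Proof.
by move=> /(colored_partition_term x); apply: leq_trans; rewrite leq_pmulr.
Qed.

Lemma colored_partition_mult_eq0 {N k n : nat}
    {m : {ffun 'I_N * 'I_k -> 'I_N.+1}} (x : 'I_N * 'I_k) :
  n <= x.1 -> m \in bounded_colored_partitions N k n -> m x = 0 :> nat.
Proof.
move=> nx /(colored_partition_term x).
by case: (nat_of_ord (m x)) => [//|q]; rewrite mulSn; lia.
Qed.

Lemma card_bounded_colored_partitions (N k n : nat) : n <= N ->
  #|bounded_colored_partitions N k n| = num_colored_partitions k n.
Proof.
move=> le_nN; symmetry; rewrite /num_colored_partitions.
(* [f] pads with multiplicity 0 on sizes above [n]; [g] restricts to sizes at most [n]. *)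
pose f (m : {ffun 'I_n * 'I_k -> 'I_n.+1}) : {ffun 'I_N * 'I_k -> 'I_N.+1} :=
  [ffun x => if insub (val x.1) is Some i then inord (m (i, x.2)) else ord0].
pose g (m : {ffun 'I_N * 'I_k -> 'I_N.+1}) : {ffun 'I_n * 'I_k -> 'I_n.+1} :=
  [ffun x => inord (m (widen_ord le_nN x.1, x.2))].
have fE m i c : f m (widen_ord le_nN i, c) = m (i, c) :> nat.
  rewrite ffunE /= insubT //= => H.
  rewrite inordK; last by apply: (leq_trans (ltn_ord _)).
  by congr (nat_of_ord (m (_, _))); apply: val_inj.
have f0 m (x : 'I_N * 'I_k) : n <= x.1 -> f m x = 0 :> nat.
  by move=> le_nx; rewrite ffunE insubF // ltnNge le_nx.
have sumE (F : 'I_N * 'I_k -> nat) :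
    (forall x : 'I_N * 'I_k, n <= x.1 -> F x = 0) ->
    \sum_x F x = \sum_(x : 'I_n * 'I_k) F (widen_ord le_nN x.1, x.2).
  move=> F0.
  transitivity (\sum_i \sum_c F (i, c)).
    by rewrite pair_big; apply: eq_bigr => -[].
  rewrite (bigID (fun i : 'I_N => i < n)) /=.
  rewrite [X in _ + X]big1 ?addn0; last first.
    by move=> i; rewrite -leqNgt => ni; apply: big1 => c _; apply: F0.
  rewrite (big_ord_narrow le_nN) pair_big /=.
  by apply: eq_bigr.
apply: (card_can_in f g).
- move=> m; rewrite !inE => /eqP sm; rewrite sumE; last first.
    by move=> x nx; rewrite f0.
  by rewrite -[X in _ == X]sm; apply/eqP/eq_bigr => -[i c] _; rewrite fE.
- move=> m mB; rewrite inE /is_colored_partition.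
  have := mB; rewrite inE sumE; last first.
    by move=> x nx; rewrite (colored_partition_mult_eq0 _ nx mB).
  move=> /eqP sm; rewrite -[X in _ == X]sm; apply/eqP/eq_bigr => x _ /=.
  by rewrite ffunE inordK // ltnS (colored_partition_mult_le _ mB).
- move=> m _; apply/ffunP => -[i c]; apply: val_inj.
  by rewrite ffunE /= fE inord_val.
- move=> m mB; apply/ffunP => x; apply: val_inj => /=.
  case: (leqP n x.1) => [nx|xn].
    by rewrite f0 // (colored_partition_mult_eq0 _ nx mB).
  have -> : x = (widen_ord le_nN (Ordinal xn), x.2).
    by case: x xn => i c /= xn; congr (_, _); apply: val_inj.
  by rewrite fE ffunE inordK // ltnS (colored_partition_mult_le _ mB).
Qed.

(** Deleting [j.+1] copies of the part [x] is a bijection onto the partitions of what remains;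
    adding them back inverts it. *)
Lemma card_multiplicity_gt (N k n j : nat) (x : 'I_N * 'I_k) : n <= N ->
  #|[set m in bounded_colored_partitions N k n | j < m x]|
  = if j.+1 * x.1.+1 <= n then num_colored_partitions k (n - j.+1 * x.1.+1)
    else 0.
Proof.
move=> le_nN; case: (leqP (j.+1 * x.1.+1) n) => [le_jn|lt_nj]; last first.
  apply: eq_card0 => m; rewrite in_set; apply/negP => /andP [].
  move=> /(colored_partition_term x) le_n lt_jm.
  have := leq_trans lt_nj (leq_trans (leq_mul lt_jm (leqnn _)) le_n).
  by rewrite ltnn.
rewrite -(card_bounded_colored_partitions N); last by lia.
pose f (m : {ffun 'I_N * 'I_k -> 'I_N.+1}) : {ffun 'I_N * 'I_k -> 'I_N.+1} :=
  [ffun y => if y == x then inord (m x - j.+1) else m y].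
pose g (m : {ffun 'I_N * 'I_k -> 'I_N.+1}) : {ffun 'I_N * 'I_k -> 'I_N.+1} :=
  [ffun y => if y == x then inord (m x + j.+1) else m y].
have fx m : f m x = m x - j.+1 :> nat.
  by rewrite ffunE eqxx inordK //; have := ltn_ord (m x); lia.
have fy m y : y != x -> f m y = m y by rewrite ffunE => /negbTE ->.
have gy m y : y != x -> g m y = m y by rewrite ffunE => /negbTE ->.
(* The increased multiplicity does not overflow [inord]: its copies of [x] have total size at most
   [n <= N]. *)
have gx m : m \in bounded_colored_partitions N k (n - j.+1 * x.1.+1) ->
    g m x = m x + j.+1 :> nat.
  move=> /(colored_partition_term x) le_m; rewrite ffunE eqxx inordK //.
  rewrite ltnS; apply: leq_trans le_nN.
  apply: (@leq_trans ((m x + j.+1) * x.1.+1)); first by rewrite leq_pmulr.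
  by rewrite mulnDl -[leqRHS](subnK le_jn) leq_add2r.
apply: (card_can_in f g).
- move=> m; rewrite !inE => /andP [/eqP sm lt_jm].
  rewrite (bigD1 x) //= in sm; rewrite (bigD1 x) //= fx.
  under eq_bigr => y yx do rewrite fy //.
  by rewrite mulnBl -sm addnBAC // leq_mul.
- move=> m mB; rewrite !inE gx // (bigD1 x) //= gx //.
  under eq_bigr => y yx do rewrite gy //.
  move: mB; rewrite inE (bigD1 x) //= => /eqP sm.
  by rewrite mulnDl addnAC sm subnK // eqxx addnS ltnS leq_addl.
- move=> m; rewrite !inE => /andP [_ lt_jm].
  apply/ffunP => y; case: (eqVneq y x) => [->|yx]; last by rewrite gy ?fy.
  apply: val_inj => /=; rewrite ffunE eqxx fx subnK // inordK //.
- move=> m mB; apply/ffunP => y.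
  case: (eqVneq y x) => [->|yx]; last by rewrite fy ?gy.
  by apply: val_inj => /=; rewrite fx gx // addnK.
Qed.

(** * The recurrence through divisor sums *)

Lemma sum_ord_divisors (n t : nat) : 0 < t <= n ->
  \sum_(i < n) \sum_(j < n) (if j.+1 * i.+1 == t then i.+1 else 0) = sigma t.
Proof.
move=> /andP [t_gt0 le_tn].
have H (i : 'I_n) : \sum_(j < n) (if j.+1 * i.+1 == t then i.+1 else 0)
    = if i.+1 %| t then i.+1 else 0.
  case: ifP => [/dvdnP [q def_t]|ndvd]; last first.
    apply: big1 => j _; case: eqP => // def_t.
    by rewrite -def_t dvdn_mull in ndvd.
  (* A divisor [i.+1] of [t] has the single cofactor [q], reached at index [q.-1]. *)
  have lt_q : q.-1 < n by nia.
  rewrite (bigD1 (Ordinal lt_q)) //= big1 ?addn0 => [|j].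
    by rewrite prednK ?def_t ?eqxx //; nia.
  rewrite -val_eqE /= => ne; case: eqP => // Ht; nia.
rewrite (eq_bigr _ (fun i _ => H i)).
rewrite /sigma big_add1 /= big_mkord [RHS]big_mkcond /=.
rewrite [RHS](big_ord_widen n (fun i => if i.+1 %| t then i.+1 else 0)) //.
rewrite [LHS](bigID (fun i : 'I_n => i < t)) /= [X in _ + X]big1 ?addn0 //.
move=> i; rewrite -leqNgt => le_ti; case: ifP => // /dvdn_leq; lia.
Qed.

(** Double count of the total size of all parts: a multiplicity [m x] is the number of [j < m x], so
    removal of [j.+1] copies counts each layer, and grouping by the removed size produces
    [sigma]. *)
Lemma num_colored_partitions_rec (k n : nat) :
  n * num_colored_partitions k n
  = k * \sum_(i < n) sigma i.+1 * num_colored_partitions k (n - i.+1).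
Proof.
set P := num_colored_partitions k.
pose A := bounded_colored_partitions n k n.
transitivity (\sum_(m in A) \sum_(x : 'I_n * 'I_k) m x * x.1.+1).
  rewrite mulnC /P -(card_bounded_colored_partitions n) // -sum_nat_const.
  by apply: eq_bigr => m; rewrite inE => /eqP ->.
rewrite exchange_big /=.
transitivity (\sum_(x : 'I_n * 'I_k) \sum_(j < n)
    (if j.+1 * x.1.+1 <= n then P (n - j.+1 * x.1.+1) else 0) * x.1.+1).
  apply: eq_bigr => x _; rewrite -big_distrl -big_distrl /=; congr (_ * _).
  under [RHS]eq_bigr => j _ do rewrite /P -card_multiplicity_gt //.
  under [RHS]eq_bigr => j _ do rewrite -sum1_card.
  transitivity (\sum_(m in A) \sum_(j < n) (if j < m x then 1 else 0)).
    apply: eq_bigr => m _; rewrite -big_mkcond /=.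
    have le_n : m x <= n by rewrite -ltnS.
    by rewrite -(big_ord_widen n (fun=> 1) le_n) sum_nat_const card_ord muln1.
  rewrite exchange_big /=; apply: eq_bigr => j _.
  rewrite -big_mkcondr /=; apply: eq_bigl => m.
  by rewrite !inE.
transitivity (\sum_(c < k) \sum_(i < n) \sum_(j < n)
    (if j.+1 * i.+1 <= n then P (n - j.+1 * i.+1) else 0) * i.+1).
  by rewrite [RHS]exchange_big pair_big; apply: eq_bigr => -[].
rewrite sum_nat_const card_ord; congr (_ * _).
(* The removed size [j.+1 * i.+1] becomes a summation variable [t.+1]; pairs with product above [n]
   match no [t]. *)
transitivity (\sum_(i < n) \sum_(j < n) \sum_(t < n)
    (if j.+1 * i.+1 == t.+1 then i.+1 else 0) * P (n - t.+1)).
  apply: eq_bigr => i _; apply: eq_bigr => j _.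
  case: (leqP (j.+1 * i.+1) n) => [le_n|lt_n]; last first.
    by symmetry; apply: big1 => t _; case: eqP => //; have := ltn_ord t; lia.
  have [t def_t] : exists t, j.+1 * i.+1 = t.+1 by exists (j.+1 * i.+1).-1; lia.
  rewrite def_t in le_n *; rewrite (bigD1 (Ordinal le_n)) //= eqxx mulnC.
  rewrite big1 ?addn0 // => u; rewrite -val_eqE /= => ne.
  by rewrite eqSS eq_sym (negbTE ne).
under [LHS]eq_bigr => i _ do rewrite exchange_big /=.
rewrite exchange_big /=; apply: eq_bigr => t _.
under [LHS]eq_bigr => i _ do rewrite -big_distrl /=.
by rewrite -big_distrl sum_ord_divisors ?ltn_ord.
Qed.

(** * Initial values and growth bounds *)

Lemma num_colored_partitions0 (k : nat) : num_colored_partitions k 0 = 1.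
Proof.
rewrite /num_colored_partitions.
rewrite -[RHS](@cards1 _ [ffun x : 'I_0 * 'I_k => @ord0 0]).
apply: eq_card => m; rewrite !inE /is_colored_partition.
have -> : m = [ffun=> ord0] by apply/ffunP => -[[]].
by rewrite eqxx big1 // => -[[]].
Qed.

Lemma sigma_ge (n : nat) : 0 < n -> n <= sigma n.
Proof.
by move=> n_gt0; rewrite /sigma big_mkcond big_nat_recr //= dvdnn leq_addl.
Qed.

Lemma sigma_le (n : nat) : 2 * sigma n <= n * n.+1.
Proof.
have : sigma n <= \sum_(1 <= d < n.+1) d.
  by rewrite /sigma big_mkcond; apply: leq_sum => d _; case: ifP.
have -> : \sum_(1 <= d < n.+1) d = \sum_(0 <= d < n.+1) d.
  by rewrite [RHS]big_nat_recl // big_add1.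
by have := bin2_sum n.+1; rewrite bin2 /=; lia.
Qed.

Lemma sigma_values : [/\ sigma 1 = 1, sigma 2 = 3, sigma 3 = 4 & sigma 4 = 7]
  /\ [/\ sigma 5 = 6, sigma 6 = 12 & sigma 7 = 8].
Proof. by rewrite /sigma unlock. Qed.

Lemma num_colored_partitions_rec_le4 (k : nat) (P := num_colored_partitions k) :
  [/\ P 1 = k, 2 * P 2 = k * (P 1 + 3), 3 * P 3 = k * (P 2 + 3 * P 1 + 4)
    & 4 * P 4 = k * (P 3 + 3 * P 2 + 4 * P 1 + 7)].
Proof.
have [[s1 s2 s3 s4] _] := sigma_values.
have r := num_colored_partitions_rec k.
have P0 := num_colored_partitions0 k.
move: (r 1) (r 2) (r 3) (r 4).
rewrite !big_ord_recr !big_ord0 /= !subSS !subn0 s1 s2 s3 s4 P0 -/P.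
by rewrite !mul1n !muln1 !add0n.
Qed.

(** The bounds are the exact values for [k = 2]; the recurrence only grows with [k]. *)
Lemma num_colored_partitions_small (k : nat) (P := num_colored_partitions k) :
  2 <= k ->
  [/\ 5 <= P 2, 10 <= P 3, 20 <= P 4 & 36 <= P 5 /\ 65 <= P 6].
Proof.
move=> hk.
have [[s1 s2 s3 s4] [s5 s6 _]] := sigma_values.
have r := num_colored_partitions_rec k.
have P0 := num_colored_partitions0 k.
have [r1 r2 r3 r4] := num_colored_partitions_rec_le4 k.
move: (r 5) (r 6).
rewrite !big_ord_recr !big_ord0 /= !subSS !subn0 s1 s2 s3 s4 s5 s6 P0 -/P.
move: r1 r2 r3 r4; rewrite -/P => r1 r2 r3 r4 r5 r6.
have lb c d Y : 0 < c -> c * P c = k * Y -> c * d <= 2 * Y -> d <= P c.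
  move=> c_gt0 e le_d; rewrite -(@leq_pmul2l c) // e.
  by apply: leq_trans le_d _; rewrite leq_mul2r hk orbT.
have h1 : 2 <= P 1 by rewrite r1.
have h2 : 5 <= P 2 by apply: lb r2 _ => //; lia.
have h3 : 10 <= P 3 by apply: lb r3 _ => //; lia.
have h4 : 20 <= P 4 by apply: lb r4 _ => //; lia.
have h5 : 36 <= P 5 by apply: lb r5 _ => //; lia.
have h6 : 65 <= P 6 by apply: lb r6 _ => //; lia.
by [].
Qed.

(* With [f n = n^2 + n + 2] and [h n = n f(n) / 2], the double partial sums of
   [P] dominate [h] because the second difference of [h] stays below [f]. *)
Lemma num_colored_partitions_ge (k n : nat) : 2 <= k -> 5 <= n ->
  n * n + n + 2 <= num_colored_partitions k n.
Proof.
set P := num_colored_partitions k => hk.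
have P0 := num_colored_partitions0 k.
have [p2 p3 p4 [p5 p6]] := num_colored_partitions_small k hk.
have [p1 _ _ _] := num_colored_partitions_rec_le4 k.
(* The induction starts at 6: for [k = 2] the bound on [S] below fails at 5, where [36 >= 32]
   suffices. *)
rewrite leq_eqVlt => /predU1P [<-|n_ge6]; first exact: leq_trans p5.
pose A m := \sum_(j < m) P j.
pose S m := \sum_(i < m) A i.+1.
(* [S m] equals the recurrence sum with [sigma i] lowered to [i], and [k >= 2] gives the factor
   2. *)
have PS m : 2 * S m <= m * P m.
  rewrite num_colored_partitions_rec; apply: leq_mul => //.
  have -> : S m = \sum_(i < m) i.+1 * P (m - i.+1).
    rewrite /S; elim: m => [|m IH]; first by rewrite !big_ord0.
    rewrite big_ord_recr /= IH [RHS]big_ord_recl /= mul1n subSS subn0.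
    rewrite /A big_ord_recr /= addnA addnC; congr (_ + _).
    rewrite [X in _ + X](reindex_inj rev_ord_inj) /= -big_split /=.
    by apply: eq_bigr => i _; rewrite /bump /= add1n subSS addnC -mulSn.
  by apply: leq_sum => i _; rewrite leq_mul2r sigma_ge ?orbT.
(* The bound on [2 * A n.+1] is the first difference of the bound on [2 * S n], so the three
   estimates propagate together. *)
suff: n * n + n + 2 <= P n /\ (n * n * n + n * n + 2 * n <= 2 * S n
    /\ 3 * n * n + 5 * n + 4 <= 2 * A n.+1) by case.
elim: n n_ge6 => [//|n IH]; rewrite leq_eqVlt => /predU1P [[<-]|n_ge6].
  rewrite /S /A !big_ord_recr !big_ord0 /= -/P.
  by move: P0 p1 p2 p3 p4 p5 p6; rewrite -/P; lia.
have [IHP [IHS IHA]] := IH n_ge6.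
have eA : A n.+2 = A n.+1 + P n.+1 by rewrite /A big_ord_recr.
have eS : S n.+1 = S n + A n.+1 by rewrite /S big_ord_recr.
have hP := PS n.+1.
have hS : n.+1 * n.+1 * n.+1 + n.+1 * n.+1 + 2 * n.+1 <= 2 * S n.+1 by nia.
have hPn : n.+1 * n.+1 + n.+1 + 2 <= P n.+1.
  rewrite -(@leq_pmul2l n.+1) //; nia.
by split=> //; split=> //; nia.
Qed.

(** For [a >= 5], [sigma (a + m)] is at most [(a + m) * (a + m + 1) / 2], below
    [m * (a * a + a + 2)]; smaller [a] leave a finite table with [a + m <= 8]. *)
Lemma sigma_add_lt (k a m : nat) : 2 <= k -> 2 <= a -> 0 < m <= a ->
  sigma (a + m) < sigma m * num_colored_partitions k a.
Proof.
move=> hk a_ge2 /andP [m_gt0 le_ma].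
have sm := sigma_ge _ m_gt0.
case: (leqP 5 a) => [a_ge5|a_lt5].
  have := num_colored_partitions_ge _ _ hk a_ge5.
  move: (num_colored_partitions k a) => p hp.
  have := sigma_le (a + m).
  have : m * (a * a + a + 2) <= sigma m * p by apply: leq_mul.
  have : m * m <= m * a by rewrite leq_mul2l le_ma orbT.
  have : a * a <= m * (a * a) by rewrite leq_pmull.
  have : 5 * a <= a * a by rewrite leq_mul2r a_ge5 orbT.
  nia.
have [p2 p3 p4 _] := num_colored_partitions_small k hk.
have [[s1 s2 s3 s4] [s5 s6 s7]] := sigma_values.
have s8 : sigma 8 = 15 by rewrite /sigma unlock.
have {sm} : a + m <= 8 by lia.
case: a a_ge2 a_lt5 le_ma => [|[|[|[|[|a]]]]] // _ _;
case: m m_gt0 => [|[|[|[|[|m]]]]] // _ _ _;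
by rewrite !addnS addn0 ?s1 ?s2 ?s3 ?s4 ?s5 ?s6 ?s7 ?s8; lia.
Qed.

(** * Comparing the recurrences at [a], [b] and [a + b] *)

Lemma mul_gt_of_sums (k a b : nat) (P := num_colored_partitions k) :
  0 < k -> 0 < a ->
  \sum_(i < a) sigma i.+1 * P (a + b - i.+1)
    + \sum_(i < b) sigma (a + i.+1) * P (b - i.+1)
  < (\sum_(i < a) sigma i.+1 * P (a - i.+1)) * P b
    + (\sum_(i < b) sigma i.+1 * P (b - i.+1)) * P a ->
  P (a + b) < P a * P b.
Proof.
move=> k_gt0 a_gt0; rewrite -(@ltn_pmul2l k) // => lt_sums.
rewrite -(@ltn_pmul2l (a + b)) ?addn_gt0 ?a_gt0 //.
have ra := num_colored_partitions_rec k a.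
have rb := num_colored_partitions_rec k b.
rewrite num_colored_partitions_rec big_split_ord /=.
under [X in _ * (_ + X)]eq_bigr => i _ do rewrite -addnS subnDl.
apply: leq_trans lt_sums _.
by rewrite mulnDr !mulnA -ra -rb -/P; lia.
Qed.

Lemma tail_sum_le (k a b : nat) (P := num_colored_partitions k) :
  2 <= k -> 2 <= a -> 0 < b <= a ->
  \sum_(i < b) sigma (a + i.+1) * P (b - i.+1)
  < (\sum_(i < b) sigma i.+1 * P (b - i.+1)) * P a.
Proof.
move=> hk a_ge2; case: b => [//|b] /= le_ba.
have lt_sigma (i : nat) : i < b.+1 -> sigma (a + i.+1) < sigma i.+1 * P a.
  by move=> lt_i; apply: sigma_add_lt => //=; apply: leq_trans le_ba.
have P0 : P 0 = 1 := num_colored_partitions0 k.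
(* The last term, with [P 0 = 1], carries the strictness; the others are compared weakly. *)
rewrite !big_ord_recr /= mulnDl subnn P0 !muln1.
rewrite -addnS leq_add ?lt_sigma // big_distrl /=; apply: leq_sum => i _.
by rewrite mulnAC leq_mul2r ltnW ?orbT // lt_sigma // ltnW // ltnS.
Qed.

(** The inductive step: weak inequalities for shorter [i] make the first sum nonnegative, and the
    tail supplies strictness. Equality cases are therefore harmless as hypotheses. *)
Lemma mul_gt_of_shorter (k a b : nat) (P := num_colored_partitions k) :
  2 <= k -> 2 <= a -> 0 < b <= a ->
  (forall i, i < a -> P (i + b) <= P i * P b) ->
  P (a + b) < P a * P b.
Proof.
move=> hk a_ge2 hb IH; apply: mul_gt_of_sums; try lia.
rewrite -addnS leq_add ?tail_sum_le // big_distrl /=; apply: leq_sum => i _.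
have lt_ia := ltn_ord i.
by rewrite -mulnA leq_mul2l addnC -addnBA // addnC IH ?orbT; lia.
Qed.

(** * Weak inequalities by induction, and the exceptional cases *)

Lemma mul_ge_of_ge3 (k a b : nat) (P := num_colored_partitions k) :
  3 <= k -> P (a + b) <= P a * P b.
Proof.
move=> hk; have [n le_n] := ubnP (a + b).
elim: n => // n IH in a b le_n *.
wlog le_ba : a b le_n / b <= a.
  move=> W; case: (leqP b a) => [|/ltnW] le; first exact: W.
  by rewrite addnC mulnC; apply: W; rewrite // addnC.
have P0 : P 0 = 1 := num_colored_partitions0 k.
case: b => [|b] in le_n le_ba *; first by rewrite addn0 P0 muln1.
case: (leqP 2 a) => [a_ge2|a_lt2].
  apply/ltnW/mul_gt_of_shorter => //; first lia.
  by move=> i lt_ia; apply: IH; lia.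
(* Here the claim is [k * (k + 3) / 2 <= k * k], which is where [3 <= k] enters. *)
have [-> ->] : a = 1 /\ b = 0 by lia.
have [] := num_colored_partitions_rec_le4 k; rewrite -/P addn1 => -> p2 _ _.
by nia.
Qed.

Lemma mul_one_gt_two_colors (a : nat) (P := num_colored_partitions 2) :
  4 <= a -> P (a + 1) < P a * P 1.
Proof.
have [p1 p2 p3 p4] := num_colored_partitions_rec_le4 2.
have P0 : P 0 = 1 := num_colored_partitions0 2.
have [_ p3' p4' [p5 _]] := num_colored_partitions_small 2 isT.
rewrite -/P in p1 p2 p3 p4 p3' p4' p5.
have [[s1 s2 s3 s4] [s5 s6 s7]] := sigma_values.
elim/ltn_ind: a => a IH a_ge4.
(* [P 2 = 5] exceeds [P 1 * P 1] by exactly 1, while [i = 2] and [i = 3] give equality. *)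
have le_P (i : nat) : i < a -> P (i + 1) <= P i * P 1 + (i == 1).
  move=> lt_ia; case: (leqP 4 i) => [i_ge4|].
    by apply: leq_trans (leq_addr _ _); apply/ltnW/IH.
  by case: i lt_ia => [|[|[|[|i]]]] //= _ _; rewrite addn1; lia.
(* The two upper bounds on [sigma] add up to [a * a + a + 1], one less than the lower bound on
   [P a]. *)
have lt_sigma : sigma (a - 1) + sigma (a + 1) < P a.
  case: (leqP 5 a) => [a_ge5|a_lt5].
    have := num_colored_partitions_ge 2 a isT a_ge5.
    have := sigma_le (a - 1); have := sigma_le (a + 1); rewrite -/P.
    by case: a a_ge4 a_ge5 {IH le_P} => // a _ _; rewrite subn1 addn1 /=; nia.
  have ea : a = 4 by lia.
  by rewrite ea subn1 addn1 s3 s5; lia.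
apply: mul_gt_of_sums; [by []|lia|].
rewrite !big_ord1 /= subnn -/P P0 s1 !mul1n !muln1.
have le_sum : \sum_(i < a) sigma i.+1 * P (a + 1 - i.+1)
    <= (\sum_(i < a) sigma i.+1 * P (a - i.+1)) * P 1 + sigma (a - 1).
  have lt_a2 : a - 2 < a by lia.
  (* The defect at remainder 1 occurs only at index [a - 2], with weight [sigma (a - 1)]. *)
  have -> : sigma (a - 1) = \sum_(i < a) sigma i.+1 * (a - i.+1 == 1).
    rewrite (bigD1 (Ordinal lt_a2)) //= big1 => [|i].
      have -> : a - (a - 2).+1 == 1 by lia.
      by rewrite addn0 muln1; congr sigma; lia.
    by rewrite -val_eqE /= => ne; case: eqP => [e|_]; [lia|rewrite muln0].
  rewrite big_distrl -big_split; apply: leq_sum => i _ /=.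
  have lt_ia := ltn_ord i.
  rewrite -mulnA -mulnDr leq_mul2l addnC -addnBA // addnC le_P ?orbT //; lia.
by apply: leq_ltn_trans (leq_add le_sum (leqnn _)) _; rewrite -addnA ltn_add2l.
Qed.

(** Once the smaller argument is at least 2, the shorter pairs never meet [(1, 1)], so the general
    step applies; argument 1 has its own lemma. *)
Lemma mul_ge_two_colors (a b : nat) (P := num_colored_partitions 2) :
  (a, b) != (1, 1) -> P (a + b) <= P a * P b.
Proof.
have [n le_n] := ubnP (a + b).
elim: n => // n IH in a b le_n *.
wlog le_ba : a b le_n / b <= a.
  move=> W ne; case: (leqP b a) => [|/ltnW] le; first exact: W.
  by rewrite addnC mulnC; apply: W; rewrite // ?xpair_eqE 1?andbC // addnC.
have [p1 p2 p3 p4] := num_colored_partitions_rec_le4 2.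
have P0 : P 0 = 1 := num_colored_partitions0 2.
rewrite -/P in p1 p2 p3 p4.
case: b => [|[|b]] in le_n le_ba *; first by rewrite addn0 P0 muln1.
  case: (leqP 4 a) => [a_ge4 _|]; first exact/ltnW/mul_one_gt_two_colors.
  by case: a {le_n le_ba} => [|[|[|[|a]]]] //= _ _; rewrite addn1; lia.
move=> _; apply/ltnW/mul_gt_of_shorter => //; first lia.
by move=> i lt_ia; apply: IH; [lia|rewrite xpair_eqE andbF].
Qed.

Theorem theorem1p2 (k : nat) (hk : 2 <= k) (a b : nat) (hb : 1 <= b)
    (hab : b <= a) :
  num_colored_partitions k a * num_colored_partitions k b
    > num_colored_partitions k (a + b)
  <-> (a, b, k) \notin [:: (1, 1, 2); (2, 1, 2); (3, 1, 2); (1, 1, 3)].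
Proof.
have [p1 p2 p3 p4] := num_colored_partitions_rec_le4 k.
split=> [lt_P|].
  (* In the listed order the product and [P (a + b)] are 4 and 5, 10 and 10, 20 and 20, 9 and 9. *)
  apply/negP; rewrite !inE => exc; move: lt_P; apply/negP; rewrite -leqNgt.
  move: exc; rewrite !xpair_eqE.
  case/or4P => /andP [/andP [/eqP ea /eqP eb] /eqP ek]; subst a b k;
    rewrite addn1; lia.
rewrite !inE !xpair_eqE => exc.
case: (leqP 3 k) => [k_ge3|k_lt3].
  case: (leqP 2 a) => [a_ge2|a_lt2].
    apply: mul_gt_of_shorter => //; first by rewrite hb.
    by move=> i _; apply: mul_ge_of_ge3.
  have [ea eb] : a = 1 /\ b = 1 by lia.
  (* With [(1, 1, 3)] excluded, [k >= 4] makes [k * k] exceed [k * (k + 3) / 2]. *)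
  subst a b; rewrite addn1; nia.
have ek : k = 2 by lia.
subst k; case: (leqP 2 b) => [b_ge2|b_lt2].
  apply: mul_gt_of_shorter; rewrite ?hb //; first by lia.
  by move=> i _; apply: mul_ge_two_colors; rewrite xpair_eqE; lia.
have eb : b = 1 by lia.
by subst b; apply: mul_one_gt_two_colors; lia.
Qed.
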